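(* Let $N\ge 1$ be an integer. Let $G_N^{\mathcal C}=(\langle \mathcal C_j,\mathcal C_k\rangle)_{j,k=1}^N$ and $G_N^{\mathcal S}=(\langle \mathcal S_j,\mathcal S_k\rangle)_{j,k=1}^N$ be the Gram matrices of $\{\mathcal C_k:1\le k\le N\}$ and $\{\mathcal S_k:1\le k\le N\}$ in $L_2(0,1)$. Then the spectra of $G_N^{\mathcal C}$ and $G_N^{\mathcal S}$ coincide.
   Context: Define $\mathcal C(x)=4\left|x-\frac12\right|-1$ and $\mathcal S(x)=\left|2-4\left|x-\frac14\right|\right|-1$ for $x\in[0,1]$, and extend both functions to $\mathbb R$ periodically with period $1$. For $k\in\mathbb N=\{1,2,\dots\}$ put $\mathcal C_k(x)=\mathcal C(kx)$ and $\mathcal S_k(x)=\mathcal S(kx)$, $x\in\mathbb R$. The inner product is $\langle f,g\rangle=\int_0^1 f(x)g(x)\,dx$. *)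

(* Defs.v *)
From HB Require Import structures.
From mathcomp Require Import all_boot all_order all_algebra.
From mathcomp Require Import all_classical all_reals all_analysis.

Set Implicit Arguments.
Unset Strict Implicit.
Unset Printing Implicit Defensive.

Import Order.TTheory GRing.Theory Num.Theory.
Import numFieldNormedType.Exports.

Local Open Scope classical_set_scope.
Local Open Scope ring_scope.

(* The 1-periodic extension to R of the restriction of f to [0, 1); it agrees
   with f at 1 as well when f 0 = f 1, as is the case for tri_cos and tri_sin. *)
Definition periodize (R : realType) (f : R -> R) (x : R) : R :=
  f (x - (Num.floor x)%:~R).

Definition tri_cos (R : realType) (x : R) : R :=
  4 * `|x - 1 / 2| - 1.

Definition tri_sin (R : realType) (x : R) : R :=
  `|2 - 4 * `|x - 1 / 4| | - 1.

Definition Cfun (R : realType) (k : nat) (x : R) : R :=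
  periodize (@tri_cos R) (k%:R * x).

Definition Sfun (R : realType) (k : nat) (x : R) : R :=
  periodize (@tri_sin R) (k%:R * x).

Definition inner01 (R : realType) (f g : R -> R) : R :=
  \int[lebesgue_measure]_(x in `[0, 1]) (f x * g x).

(* The family is indexed from 1: row j : 'I_N corresponds to f j.+1. *)
Definition gram (R : realType) (f : nat -> R -> R) (N : nat) : 'M[R]_N :=
  \matrix_(j < N, k < N) inner01 (f j.+1) (f k.+1).

Definition spectrum (F : fieldType) (n : nat) (A : 'M[F]_n) : set F :=
  [set a | eigenvalue A a].

(* Geometric multiplicity; for the real symmetric matrices considered here it
   is the same as the algebraic one. *)
Definition multiplicity (F : fieldType) (n : nat) (A : 'M[F]_n) (a : F) : nat :=
  \rank (eigenspace A a).

(* Main.v *)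
(* Let T be the 1-periodic triangle wave, so that C_k(x) = T(kx),
   S_k(x) = T(kx - 1/4) and T(y + q/2) = (-1)^q T(y) for q in N.  If j = 2^e u
   with u odd, then S_j(x + c) = (-1)^((u-1)/2) C_j(x) for c = 1/(4 * 2^e), a
   shift that depends on e only.  As the integral of a 1-periodic function over
   [0, 1] is invariant under shifts, <S_j, S_k> and <C_j, C_k> agree up to the
   sign (-1)^((u-1)/2) (-1)^((v-1)/2) when j = 2^e u and k = 2^e v.  When the
   2-adic valuations of j and k differ, the shift by 1/2^(e+1), with e the
   smaller one, negates one factor and fixes the other, so both inner products
   vanish.  Hence G^S = D G^C D with D a diagonal matrix of signs. *)

Require Import Defs.
From HB Require Import structures.
From mathcomp Require Import all_boot all_order all_algebra.
From mathcomp Require Import all_classical all_reals all_analysis.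
From mathcomp Require Import measurable_realfun ring lra.

Set Implicit Arguments.
Unset Strict Implicit.
Unset Printing Implicit Defensive.

Import Order.TTheory GRing.Theory Num.Theory.
Import numFieldNormedType.Exports.

Local Open Scope classical_set_scope.
Local Open Scope ring_scope.

(** * Measurability of periodizations and translation of integrals *)

Lemma measurable_floor (R : realType) :
  measurable_fun [set: R] (fun x : R => (Num.floor x)%:~R : R).
Proof.
by apply: nondecreasing_measurable => // x y xy; rewrite ler_int le_floor.
Qed.

Lemma measurable_periodize (R : realType) (f : R -> R) :
  measurable_fun [set: R] f -> measurable_fun [set: R] (periodize f).
Proof.
move=> mf; apply: (measurableT_comp mf).
by apply: measurable_funB => //; exact: measurable_floor.
Qed.

Lemma periodizeE (R : realType) (f : R -> R) (m : int) (x : R) :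
  m%:~R <= x < m%:~R + 1 -> periodize f x = f (x - m%:~R).
Proof. by rewrite -intrD1 => /floor_def; rewrite /periodize => ->. Qed.

Lemma shift_preimage_itv (R : realType) (c a b : R) (s t : bool) :
  (fun x : R => x + c) @^-1` [set` Interval (BSide s (a + c)) (BSide t (b + c))]
  = [set` Interval (BSide s a) (BSide t b)].
Proof.
by apply/seteqP; split => x; rewrite /= !in_itv; case: s; case: t;
  rewrite /= ?lerD2r ?ltrD2r.
Qed.

Lemma measurable_shift (R : realType) (c : R) :
  measurable_fun [set: R] (fun x : R => x + c).
Proof. exact: measurable_funD. Qed.

(** By uniqueness of Lebesgue measure: the pushforward gives each half-open interval its length, the
    preimage being the interval moved by [-c]. *)
Lemma lebesgue_measure_shift (R : realType) (c : R) (A : set R) :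
  measurable A ->
  pushforward lebesgue_measure
    ((fun x : R => x + c) : _ -> measurableTypeR R) A = lebesgue_measure A.
Proof.
move=> mA; apply/esym.
have mc : measurable_fun [set: measurableTypeR R]
    ((fun x : R => x + c) : _ -> measurableTypeR R) by exact: measurable_shift.
apply: (@lebesgue_measure_unique R (pushforward lebesgue_measure
    ((fun x : R => x + c) : _ -> measurableTypeR R))) => //= _ [[a b]] _ <-.
rewrite /pushforward /= -{2}(subrK c a) -{2}(subrK c b) shift_preimage_itv.
rewrite !lebesgue_measure_itv/= !lte_fin ltrD2r.
by case: ifP => // _; congr (_%:E); ring.
Qed.

Lemma bounded_integrable_itv (R : realType) (f : R -> R) (M a b : R)
    (s t : bool) :
  measurable_fun [set: R] f -> (forall x, `|f x| <= M) ->
  lebesgue_measure.-integrable [set` Interval (BSide s a) (BSide t b)]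
    (EFin \o f).
Proof.
move=> mf bf; apply: measurable_bounded_integrable => //.
- rewrite [ltLHS]lebesgue_measure_itv/=.
  by case: ifP => // _; rewrite -EFinB ltry.
- exact: measurable_funTS.
- exists M; split; first exact: num_real.
  by move=> x Mx y _; apply: le_trans (bf y) (ltW Mx).
Qed.

Lemma Rintegral_shift (R : realType) (f : R -> R) (M a b c : R) (s t : bool) :
  measurable_fun [set: R] f -> (forall x, `|f x| <= M) ->
  \int[lebesgue_measure]_(x in
    [set` Interval (BSide s (a + c)) (BSide t (b + c))]) f x =
  \int[lebesgue_measure]_(x in
    [set` Interval (BSide s a) (BSide t b)]) f (x + c).
Proof.
move=> mf bf; rewrite /Rintegral; congr fine.
rewrite -[in RHS](shift_preimage_itv c).
have mc : measurable_fun [set: measurableTypeR R]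
    ((fun x : R => x + c) : _ -> measurableTypeR R) by exact: measurable_shift.
transitivity (\int[pushforward lebesgue_measure
    ((fun x : R => x + c)%R : measurableTypeR R -> measurableTypeR R)]_(x in
    [set` Interval (BSide s (a + c)%R) (BSide t (b + c)%R)]) (f x)%:E)%E.
  by apply: eq_measure_integral => A mA _; exact/esym/lebesgue_measure_shift.
rewrite integral_pushforward//.
- exact/measurable_EFinP.
- rewrite shift_preimage_itv.
  apply: (bounded_integrable_itv (M := M) a b s t) => //.
  exact: (measurableT_comp mf (measurable_shift c)).
Qed.

(** The left side is the integral over [c, 1 + c]. It shares [c, 1] with [0, 1], and periodicity
    carries the rest, [1, 1 + c], back onto [0, c]. *)
Lemma Rintegral_periodic_shift (R : realType) (f : R -> R) (M c : R) :
  measurable_fun [set: R] f -> (forall x, `|f x| <= M) ->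
  (forall x, f (x + 1) = f x) -> 0 <= c <= 1 ->
  \int[lebesgue_measure]_(x in `[0, 1]) f (x + c) =
  \int[lebesgue_measure]_(x in `[0, 1]) f x.
Proof.
move=> mf bf pf /andP[c0 c1].
have intf a b s t := bounded_integrable_itv a b s t mf bf.
have split3 (x y z : R) : x <= y -> y <= z ->
    \int[lebesgue_measure]_(t in `[x, z[) f t =
    \int[lebesgue_measure]_(t in `[x, y[) f t +
    \int[lebesgue_measure]_(t in `[y, z[) f t.
  move=> xy yz; rewrite (@itv_bndbnd_setU _ _ _ (BLeft y)) ?bnd_simp//.
  rewrite Rintegral_setU//=.
    by rewrite -itv_bndbnd_setU ?bnd_simp//; exact: intf.
  apply/disj_setPS => t /=; rewrite !in_itv/= => -[/andP[_ ty] /andP[yt _]].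
  by move: (lt_le_trans ty yt); rewrite ltxx.
rewrite -(Rintegral_shift 0 1 c true false mf bf).
(* Half-open intervals make the pieces of [split3] disjoint. *)
rewrite -!Rintegral_itv_bndo_bndc; [|exact: intf..].
rewrite add0r (split3 _ 1) ?lerDl// [RHS](split3 _ c)// addrC; congr (_ + _).
rewrite -{1}[1 : R]add0r (addrC 1 c) (Rintegral_shift 0 c 1 true true mf bf).
by apply: eq_Rintegral => x _; rewrite pf.
Qed.

(** * The triangle wave and its symmetries *)

Section triangle.
Variable R : realType.

Let tri : R -> R := periodize (@tri_cos R).

Lemma measurable_tri : measurable_fun [set: R] tri.
Proof.
apply: measurable_periodize; apply: measurable_funB => //.
apply: measurable_funM => //; apply: measurableT_comp => //.
exact: measurable_funB.
Qed.

Lemma frac_itv (y : R) : 0 <= y - (Num.floor y)%:~R < 1.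
Proof.
by have := floor_itv y; rewrite intrD => /andP[? ?]; apply/andP; split; lra.
Qed.

Lemma tri_le1 (y : R) : `|tri y| <= 1.
Proof.
rewrite /tri /periodize /tri_cos; have := frac_itv y.
move: (y - _) => z /andP[z0 z1]; rewrite ler_norml.
by case: (ger0P (z - 1 / 2)) => ?; apply/andP; split; lra.
Qed.

Lemma tri_half (y : R) : tri (y + 1 / 2) = - tri y.
Proof.
rewrite {2}/tri /periodize; have := frac_itv y.
set m := Num.floor y; set z := y - _ => /andP[z0 z1].
have -> : y = z + m%:~R by rewrite subrK.
(* The floor of [y + 1 / 2] is [m] or [m + 1] according to this comparison. *)
case: (ltrP z (1 / 2)) => z2.
- rewrite /tri (@periodizeE _ _ m) ?intrD; last first.
    by rewrite ?intrD; apply/andP; split; lra.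
  rewrite /tri_cos ger0_norm; last by lra.
  rewrite ler0_norm; lra.
- rewrite /tri (@periodizeE _ _ (m + 1)) ?intrD; last first.
    by rewrite ?intrD; apply/andP; split; lra.
  rewrite /tri_cos ler0_norm; last by lra.
  rewrite ger0_norm; lra.
Qed.

Lemma tri_halves (q : nat) (y : R) : tri (y + q%:R / 2) = (-1) ^+ q * tri y.
Proof.
elim: q y => [|q IH] y; first by rewrite mul0r addr0 mul1r.
rewrite exprS -mulrA -IH mulN1r -tri_half; congr tri.
by rewrite -natr1; lra.
Qed.

Lemma periodize_tri_sin (y : R) : periodize (@tri_sin R) y = tri (y - 1 / 4).
Proof.
rewrite {1}/periodize; have := frac_itv y.
set m := Num.floor y; set z := y - _ => /andP[z0 z1].
have -> : y = z + m%:~R by rewrite subrK.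
(* Below 1/4, the delayed argument falls into the previous period, so its floor is [m - 1]. *)
case: (ltrP z (1 / 4)) => z4.
- rewrite /tri (@periodizeE _ _ (m - 1)) ?intrD; last first.
    by rewrite ?intrD; apply/andP; split; lra.
  rewrite /tri_sin /tri_cos (@ler0_norm _ (z - _)); last by lra.
  by rewrite !ger0_norm; lra.
- rewrite /tri (@periodizeE _ _ m) ?intrD; last first.
    by rewrite ?intrD; apply/andP; split; lra.
  rewrite /tri_sin /tri_cos (@ger0_norm _ (z - _)); last by lra.
  by case: (ger0P (2 - 4 * (z - 1 / 4))) => ?;
    case: (ger0P (z + m%:~R - 1 / 4 - m%:~R - 1 / 2)) => ?; lra.
Qed.

(** The phase [a] puts both families under one definition: 0 gives [Cfun], 1/4 gives [Sfun]. *)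
Definition tri_wave (a : R) (k : nat) (x : R) : R := tri (k%:R * x - a).

Lemma CfunE : @Cfun R = tri_wave 0.
Proof. by apply/funext => k; apply/funext => x; rewrite /tri_wave subr0. Qed.

Lemma SfunE : @Sfun R = tri_wave (1 / 4).
Proof.
by apply/funext => k; apply/funext => x; rewrite /Sfun periodize_tri_sin.
Qed.

(** The hypothesis says that translating by [c] and passing from phase [a] to phase [b] differ by
    [q] half periods, each of which contributes a sign. *)
Lemma tri_wave_shift (a b : R) (k q : nat) (x c : R) :
  k%:R * c - a + b = q%:R / 2 ->
  tri_wave a k (x + c) = (-1) ^+ q * tri_wave b k x.
Proof.
by move=> kc; rewrite /tri_wave -tri_halves -kc; congr tri; ring.
Qed.

Lemma measurable_tri_wave (a : R) (k : nat) :
  measurable_fun [set: R] (tri_wave a k).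
Proof.
apply: (measurableT_comp measurable_tri).
by apply: measurable_funB => //; apply: measurable_funM.
Qed.

Lemma tri_waveM_le1 (a b : R) (j k : nat) (x : R) :
  `|tri_wave a j x * tri_wave b k x| <= 1.
Proof. by rewrite normrM mulr_ile1// tri_le1. Qed.

Lemma measurable_tri_waveM (a b : R) (j k : nat) :
  measurable_fun [set: R] (fun x => tri_wave a j x * tri_wave b k x).
Proof. by apply: measurable_funM; exact: measurable_tri_wave. Qed.

Lemma tri_wave_period (a : R) (k : nat) (x : R) :
  tri_wave a k (x + 1) = tri_wave a k x.
Proof.
(* A unit step in [x] is [k * 2] half periods, an even number. *)
rewrite (@tri_wave_shift a a _ (k * 2)); last by rewrite natrM; lra.
by rewrite mulnC exprM sqrrN !expr1n mul1r.
Qed.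

Lemma inner01_tri_wave_shift (a b c : R) (j k p q : nat) : 0 <= c <= 1 ->
  j%:R * c - a + b = p%:R / 2 -> k%:R * c - a + b = q%:R / 2 ->
  inner01 (tri_wave a j) (tri_wave a k) =
  (-1) ^+ p * (-1) ^+ q * inner01 (tri_wave b j) (tri_wave b k).
Proof.
move=> c01 jc kc; rewrite /inner01.
rewrite -(Rintegral_periodic_shift (M := 1) _ _ _ c01); last 3 first.
- exact: measurable_tri_waveM.
- exact: tri_waveM_le1.
- by move=> x; rewrite !tri_wave_period.
rewrite -RintegralZl//; last first.
  by apply: (@bounded_integrable_itv _ _ 1);
    [exact: measurable_tri_waveM | exact: tri_waveM_le1].
apply: eq_Rintegral => x _.
by rewrite (tri_wave_shift _ jc) (tri_wave_shift _ kc) mulrACA.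
Qed.

Lemma inner01C (f g : R -> R) : inner01 f g = inner01 g f.
Proof. by apply: eq_Rintegral => x _; rewrite mulrC. Qed.

Lemma odd_part_spec (k : nat) : (0 < k)%N ->
  exists2 u, odd u & k = (u * 2 ^ logn 2 k)%N.
Proof.
by move=> /(pfactor_coprime (isT : prime 2))[u u2 ku]; exists u;
  rewrite // -coprime2n.
Qed.

Lemma inner01_tri_wave0 (a : R) (j k : nat) : (0 < j)%N -> (0 < k)%N ->
  logn 2 j != logn 2 k -> inner01 (tri_wave a j) (tri_wave a k) = 0.
Proof.
wlog: j k / (logn 2 j < logn 2 k)%N => [H j0 k0 jk|lt_jk j0 k0 _].
  case: (ltngtP (logn 2 j) (logn 2 k)) (jk) => // ?; first by rewrite H.
  by rewrite inner01C H// eq_sym.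
have [u uodd ju] := odd_part_spec j0; have [v _ kv] := odd_part_spec k0.
set e := logn 2 j in lt_jk ju; set e' := logn 2 k in lt_jk kv.
have P1 : 1 <= (2 ^ e)%:R :> R by rewrite ler1n expn_gt0.
set P : R := (2 ^ e)%:R in P1.
have jP : j%:R = u%:R * P by rewrite ju natrM.
have kP : k%:R = (v * 2 ^ (e' - e))%:R * P.
  by rewrite kv -{1}(subnK (ltnW lt_jk)) expnD mulnA natrM.
have ee : (v * 2 ^ (e' - e) = v * 2 ^ (e' - e).-1 * 2)%N.
  by rewrite -mulnA -expnSr prednK// subn_gt0.
(* The shift advances the two waves by [u] (odd) and [v * 2 ^ (e' - e)] (even) half periods, so the
   inner product equals its own negative. *)
have := @inner01_tri_wave_shift a a (2 * P)^-1 j k u (v * 2 ^ (e' - e)).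
rewrite -signr_odd uodd -(signr_odd _ (v * _)) ee oddM andbF mulr1 mulN1r.
move=> H; suff : inner01 (tri_wave a j) (tri_wave a k) =
  - inner01 (tri_wave a j) (tri_wave a k) by lra.
apply: H.
- by rewrite invr_ge0 invf_le1; [apply/andP; split; lra | lra].
- by rewrite jP subrK; field; rewrite pnatr_eq0 expn_eq0.
- by rewrite kP ee subrK; field; rewrite pnatr_eq0 expn_eq0.
Qed.

(* The nontrivial character mod 4 evaluated at the odd part of k. *)
Definition odd_part_sign (k : nat) : R :=
  (-1) ^+ (k %/ 2 ^ logn 2 k)./2.

Lemma odd_part_sign_sqr (k : nat) : odd_part_sign k * odd_part_sign k = 1.
Proof. by rewrite -expr2 sqrr_sign. Qed.

Lemma inner01_SfunE (j k : nat) : (0 < j)%N -> (0 < k)%N ->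
  inner01 (@Sfun R j) (@Sfun R k) =
  odd_part_sign j * odd_part_sign k * inner01 (@Cfun R j) (@Cfun R k).
Proof.
rewrite SfunE CfunE => j0 k0.
have [jk|jk] := eqVneq (logn 2 j) (logn 2 k); last first.
  by rewrite !inner01_tri_wave0// mulr0.
have [u uodd ju] := odd_part_spec j0; have [v vodd kv] := odd_part_spec k0.
rewrite /odd_part_sign; rewrite -jk in kv *.
set e := logn 2 j in ju kv *.
have e0 : (0 < 2 ^ e)%N by rewrite expn_gt0.
have P1 : 1 <= (2 ^ e)%:R :> R by rewrite ler1n.
(* Since w = 2 [w./2] + 1, a quarter-period phase is absorbed with exactly [w./2] half periods left
   over, the exponent in [odd_part_sign]. The [+ 0] is the target phase of [Cfun]. *)
have odd4 (w : nat) : odd w -> w%:R / 4 - 1 / 4 + 0 = w./2%:R / 2 :> R.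
  move=> ow; rewrite -[in LHS](odd_double_half w) ow -muln2 natrD natrM mulr1n.
  by lra.
rewrite ju kv !mulnK//.
apply: (inner01_tri_wave_shift (c := (4 * (2 ^ e)%:R)^-1)).
- by rewrite invr_ge0 invf_le1; [apply/andP; split; lra | lra].
- by rewrite -odd4// natrM; field; rewrite pnatr_eq0 expn_eq0.
- by rewrite -odd4// natrM; field; rewrite pnatr_eq0 expn_eq0.
Qed.

End triangle.

(** * Conjugation by a diagonal matrix of signs *)

Lemma mxrank_unit_conj (F : fieldType) (n : nat) (D A : 'M[F]_n) :
  D \in unitmx -> \rank (D *m A *m D) = \rank A.
Proof.
by move=> uD; rewrite mxrankMfree ?row_free_unit// eqmxMfull ?row_full_unit.
Qed.

(** As [D] is its own inverse, conjugating by it fixes the scalar matrix [a%:M], so the two shifted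
    matrices are conjugate and have kernels of equal rank. *)
Lemma multiplicity_conj (F : fieldType) (n : nat) (D A : 'M[F]_n) (a : F) :
  D *m D = 1%:M -> multiplicity (D *m A *m D) a = multiplicity A a.
Proof.
move=> DD; rewrite /multiplicity /eigenspace !mxrank_ker.
have -> : D *m A *m D - a%:M = D *m (A - a%:M) *m D.
  by rewrite mulmxBr mulmxBl mul_mx_scalar -scalemxAl DD scalemx1.
by rewrite mxrank_unit_conj//; case: (mulmx1_unit DD).
Qed.

Lemma gram_conj (R : realType) (N : nat) :
  let D := diag_mx (\row_(k < N) odd_part_sign R k.+1) in
  gram (@Sfun R) N = D *m gram (@Cfun R) N *m D.
Proof.
apply/matrixP => j k; rewrite mul_mx_diag mul_diag_mx !mxE inner01_SfunE//.
by rewrite mulrAC.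
Qed.

Theorem theorem2p2 (R : realType) (N : nat) (hN : (1 <= N)%N) :
  spectrum (gram (@Cfun R) N) = spectrum (gram (@Sfun R) N) /\
  (forall a : R,
     multiplicity (gram (@Cfun R) N) a = multiplicity (gram (@Sfun R) N) a).
Proof.
have mE a :
    multiplicity (gram (@Cfun R) N) a = multiplicity (gram (@Sfun R) N) a.
  rewrite gram_conj multiplicity_conj// mulmx_diag -diag_const_mx.
  by congr diag_mx; apply/rowP => k; rewrite !mxE odd_part_sign_sqr.
split=> //; apply/seteqP.
(* An eigenvalue is a scalar of nonzero multiplicity, so [mE] also yields equality of the
   spectra. *)
by split=> a; rewrite /spectrum/= /eigenvalue -!mxrank_eq0
  -!/(multiplicity _ _) mE.
Qed.
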